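(* Let $\mathbb{K}$ be an algebraically closed field and let $R$ be an augmented down-up algebra over $\mathbb{K}$. Then every non-zero ideal of $R$ has non-zero intersection with the centre $Z(R)$, and the localization of $R$ at $Z(R)\setminus\{0\}$ is simple.
   Context: Augmented down-up algebra: let $q\in\mathbb{K}\setminus\{0\}$ be not a root of unity, let $A=\mathbb{K}[c,k^{\pm 1}]$ (commutative, polynomial in $c$, Laurent polynomial in $k$), and let $\alpha$ be the $\mathbb{K}$-automorphism of $A$ with $\alpha(k)=q^2k$ and $\alpha(c)=c$. Fix a non-zero integer $n$ and a Laurent polynomial $f(k)=\sum_i a_ik^i\in\mathbb{K}[k,k^{-1}]$ with $a_n=0$. Let $u=ck^n+f(k)$ and $v=u-\alpha(u)=(1-q^{2n})ck^n+\sum_i(1-q^{2i})a_ik^i$. The associated augmented down-up algebra is the ambiskew polynomial algebra $R=R(A,\alpha,v,1)$, i.e. the iterated skew polynomial ring $A[y;\alpha][x;\beta,\delta]$ where $\beta=\alpha^{-1}$ on $A$, $\beta(y)=y$, $\delta(A)=0$, $\delta(y)=v$; equivalently, the $\mathbb{K}$-algebra generated by $k^{\pm1},c,x,y$ with $c$ central, $kk^{-1}=1=k^{-1}k$, $xk=q^{-2}kx$, $yk=q^2ky$ and $xy-yx=v$. *)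

(* Defs.v *)
From HB Require Import structures.
From mathcomp Require Import all_boot all_order all_algebra finmap.
From mathcomp.multinomials Require Import monalg.

Set Implicit Arguments.
Unset Strict Implicit.
Unset Printing Implicit Defensive.

Import GRing.Theory.
Local Open Scope ring_scope.

Record skew_derivation (A : nzRingType) (s : A -> A) := SkewDerivation {
  skder :> {additive A -> A};
  skderM : forall a b, skder (a * b) = s a * skder b + skder a * b
}.

Section NullDerivation.
Variables (A : nzRingType) (s : A -> A).

Fact null_skderM (a b : A) :
  (\0 : {additive A -> A}) (a * b) = s a * (\0 : {additive A -> A}) b
    + (\0 : {additive A -> A}) a * b.
Proof. by rewrite /= mulr0 mul0r addr0. Qed.

Definition null_skew_derivation : skew_derivation s :=
  SkewDerivation null_skderM.
End NullDerivation.

(* A[y; s, d] with y a = s(a) y + d(a): the element \sum_i a_i y^i, with its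
   coefficients on the left, is encoded by the polynomial \sum_i a_i 'X^i. *)
Definition skew_poly (A : nzRingType) (s : {rmorphism A -> A})
  (d : skew_derivation s) : Type := {poly A}.

Section SkewPoly.
Variables (A : nzRingType) (s : {rmorphism A -> A}) (d : skew_derivation s).
Implicit Types (a : A) (p r : {poly A}).

(* p |-> y p *)
Definition skew_shift p : {poly A} := map_poly s p * 'X + map_poly d p.

Definition skew_mul p r : {poly A} :=
  \sum_(i < size p) p`_i *: iter i skew_shift r.

Lemma skew_shiftD : {morph skew_shift : p r / p + r}.
Proof.
move=> p r; apply/polyP=> i.
by rewrite /skew_shift !(coefD, coefMX, coef_map) !raddfD /=; case: i => [|i];
  rewrite ?coefD ?coef_map ?raddfD /= ?addr0 ?add0r // addrACA.
Qed.

Lemma skew_shift0 : skew_shift 0 = 0.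
Proof. by rewrite /skew_shift !raddf0 mul0r addr0. Qed.

Lemma skew_shiftZ a r :
  skew_shift (a *: r) = s a *: skew_shift r + d a *: r.
Proof.
apply/polyP=> i; rewrite /skew_shift !(coefD, coefMX, coefZ, coef_map) /=.
rewrite skderM; case: i => [|i] /=; first by rewrite !add0r.
by rewrite rmorphM mulrDr addrA.
Qed.

Lemma iter_skew_shiftD i : {morph iter i skew_shift : p r / p + r}.
Proof. by move=> p r; elim: i => //= i ->; rewrite skew_shiftD. Qed.

Lemma iter_skew_shift0 i : iter i skew_shift 0 = 0.
Proof. by elim: i => //= i ->; rewrite skew_shift0. Qed.

Lemma skew_mulEw n p r : (size p <= n)%N ->
  skew_mul p r = \sum_(i < n) p`_i *: iter i skew_shift r.
Proof.
move=> le_pn; rewrite /skew_mul (big_ord_widen_cond n xpredT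
  (fun i => p`_i *: iter i skew_shift r)) // big_mkcond /=.
apply: eq_bigr => i _; case: ltnP => // le_pi.
by rewrite nth_default // scale0r.
Qed.

Lemma skew_mulDl : left_distributive skew_mul +%R.
Proof.
move=> p1 p2 r; pose n := maxn (size p1) (size p2).
rewrite !(@skew_mulEw n) ?leq_maxl ?leq_maxr ?size_polyD //.
by rewrite -big_split; apply: eq_bigr => i _; rewrite coefD scalerDl.
Qed.

Lemma skew_mulDr : right_distributive skew_mul +%R.
Proof.
move=> p r1 r2; rewrite /skew_mul -big_split; apply: eq_bigr => i _ /=.
by rewrite iter_skew_shiftD scalerDr.
Qed.

Lemma skew_mul0r p : skew_mul p 0 = 0.
Proof.
by apply: big1 => i _; rewrite iter_skew_shift0 scaler0.
Qed.

Lemma skew_mul0l r : skew_mul 0 r = 0.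
Proof. by rewrite /skew_mul size_poly0 big_ord0. Qed.

Lemma skew_mulZ a p r : skew_mul (a *: p) r = a *: skew_mul p r.
Proof.
rewrite (@skew_mulEw (size p)) ?size_scale_leq // scaler_sumr.
by apply: eq_bigr => i _; rewrite coefZ scalerA.
Qed.

Lemma skew_mulXn i r : skew_mul 'X^i r = iter i skew_shift r.
Proof.
rewrite /skew_mul size_polyXn big_ord_recr /= coefXn eqxx scale1r.
rewrite big1 ?add0r // => j _.
by rewrite coefXn (ltn_eqF (ltn_ord j)) scale0r.
Qed.

Lemma skew_mulC a r : skew_mul a%:P r = a *: r.
Proof. by rewrite -alg_polyC skew_mulZ -(expr0 'X) skew_mulXn. Qed.

Lemma skew_mulCXn a i r : skew_mul (a *: 'X^i) r = a *: iter i skew_shift r.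
Proof. by rewrite skew_mulZ skew_mulXn. Qed.

Lemma skew_shiftXn i : skew_shift 'X^i = 'X^(i.+1).
Proof.
rewrite /skew_shift map_polyXn -exprSr; apply/polyP=> j.
have d1 : d 1 = 0.
  have := skderM d 1 1; rewrite !mulr1 rmorph1 mul1r => /eqP.
  by rewrite -subr_eq subrr eq_sym => /eqP.
rewrite coefD coef_map /= [X in d X]coefXn; case: eqP => _ /=.
  by rewrite d1 addr0.
by rewrite raddf0 addr0.
Qed.

Lemma skew_mulr1 p : skew_mul p 1 = p.
Proof.
have it i : iter i skew_shift 1 = 'X^i.
  by elim: i => //= i ->; rewrite skew_shiftXn.
rewrite /skew_mul -[RHS]coefK poly_def.
by apply: eq_bigr => i _; rewrite it.
Qed.

Lemma skew_mul1r r : skew_mul 1 r = r.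
Proof. by rewrite (skew_mulXn 0). Qed.

Lemma skew_mul_suml n (F : 'I_n -> {poly A}) r :
  skew_mul (\sum_i F i) r = \sum_i skew_mul (F i) r.
Proof.
exact: (big_morph (skew_mul^~ r) (fun p q => skew_mulDl p q r) (skew_mul0l r)).
Qed.

Lemma skew_mul_sumr n (F : 'I_n -> {poly A}) p :
  skew_mul p (\sum_i F i) = \sum_i skew_mul p (F i).
Proof. exact: (big_morph (skew_mul p) (skew_mulDr p) (skew_mul0r p)). Qed.

Lemma skew_shift_mul p r : skew_shift (skew_mul p r) = skew_mul (skew_shift p) r.
Proof.
rewrite -[p]coefK poly_def skew_mul_suml.
rewrite !(big_morph skew_shift skew_shiftD skew_shift0) skew_mul_suml.
apply: eq_bigr => i _; rewrite skew_mulCXn !skew_shiftZ skew_shiftXn.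
by rewrite skew_mulDl !skew_mulCXn.
Qed.

Lemma iter_skew_shift_mul i p r :
  iter i skew_shift (skew_mul p r) = skew_mul (iter i skew_shift p) r.
Proof. by elim: i => //= i ->; rewrite skew_shift_mul. Qed.

Lemma skew_mulA : associative skew_mul.
Proof.
move=> p q r; rewrite -[p]coefK poly_def (skew_mul_suml _ (skew_mul q r)) (skew_mul_suml _ q) skew_mul_suml.
by apply: eq_bigr => i _; rewrite !skew_mulCXn iter_skew_shift_mul skew_mulZ.
Qed.

HB.instance Definition _ := GRing.Zmodule.copy (skew_poly d) {poly A}.
HB.instance Definition _ := GRing.Zmodule_isNzRing.Build (skew_poly d)
  skew_mulA skew_mul1r skew_mulr1 skew_mulDl skew_mulDr (oner_neq0 {poly A}).

Definition skew_polyC a : skew_poly d := a%:P.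
Definition skew_polyX : skew_poly d := ('X : {poly A}).

Lemma skew_polyC_is_zmod_morphism : zmod_morphism skew_polyC.
Proof. by move=> a b; rewrite /skew_polyC polyCB. Qed.

Lemma skew_polyC_is_monoid_morphism : monoid_morphism skew_polyC.
Proof.
by split=> // a b; rewrite -[RHS]/(skew_mul _ _) skew_mulC -mul_polyC -polyCM.
Qed.

HB.instance Definition _ := GRing.isZmodMorphism.Build A (skew_poly d)
  skew_polyC skew_polyC_is_zmod_morphism.
HB.instance Definition _ := GRing.isMonoidMorphism.Build A (skew_poly d)
  skew_polyC skew_polyC_is_monoid_morphism.

Lemma skew_polyE (p : skew_poly d) :
  p = \sum_(i < size (p : {poly A}))
        skew_polyC (p : {poly A})`_i * skew_polyX ^+ i.
Proof.
have XnE i : skew_polyX ^+ i = 'X^i :> {poly A}.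
  elim: i => // i IH; rewrite exprS -[LHS]/(skew_mul 'X _) IH.
  by rewrite (skew_mulXn 1) /= skew_shiftXn.
rewrite -[LHS](@coefK A) poly_def; apply: eq_bigr => i _.
by rewrite -[RHS]/(skew_mul _ _) XnE skew_mulC.
Qed.

Lemma skew_polyXC a :
  skew_polyX * skew_polyC a = skew_polyC (s a) * skew_polyX + skew_polyC (d a).
Proof.
rewrite -[LHS]/(skew_mul 'X^1 a%:P) skew_mulXn /= /skew_shift.
rewrite -[skew_polyC (s a) * _]/(skew_mul (s a)%:P 'X) skew_mulC.
by rewrite !map_polyC /= mul_polyC.
Qed.

End SkewPoly.

Section Ambiskew.
Variables (A : comNzRingType) (s s' : {rmorphism A -> A}).
Variables (sK : cancel s s') (s'K : cancel s' s) (v : A).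

(* A[y; s] *)
Definition ambi_base := skew_poly (null_skew_derivation s).

Let T := skew_shift (null_skew_derivation s).

Let TE p : T p = map_poly s p * 'X.
Proof.
rewrite /T /skew_shift; apply/polyP=> i; rewrite coefD [X in _ + X]coef_map /=.
by rewrite addr0.
Qed.

Let mulE (p r : ambi_base) : p * r = skew_mul (null_skew_derivation s) p r.
Proof. by []. Qed.

(* The automorphism of A[y; s] extending s^-1 = s' and fixing y. *)
Definition ambi_beta of cancel s s' & cancel s' s : ambi_base -> ambi_base :=
  fun p => map_poly s' (p : {poly A}).

Local Notation beta := (ambi_beta sK s'K).

Let betaT p : beta (T p) = T (beta p).
Proof.
rewrite !TE; apply/polyP=> i; rewrite coef_map /= !coefMX.
case: i => [|i] /=; first exact: rmorph0.
by rewrite !coef_map /= sK s'K.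
Qed.

Lemma ambi_beta_is_zmod_morphism : zmod_morphism beta.
Proof. by move=> p r; exact: (rmorphB (map_poly s')). Qed.

HB.instance Definition _ := GRing.isZmodMorphism.Build ambi_base ambi_base
  (ambi_beta sK s'K) ambi_beta_is_zmod_morphism.

Let betaZ a (p : {poly A}) : beta (a *: p) = s' a *: (beta p : {poly A}).
Proof. exact: map_polyZ. Qed.

Let beta_iter i p : beta (iter i T p) = iter i T (beta p).
Proof. by elim: i => //= i <-; rewrite betaT. Qed.

Lemma ambi_beta_is_monoid_morphism : monoid_morphism beta.
Proof.
split=> [|p r]; first exact: (rmorph1 (map_poly s')).
have le_bp : (size (beta p : {poly A}) <= size (p : {poly A}))%N.
  exact: size_poly.
rewrite !mulE (skew_mulEw _ _ le_bp) [LHS](raddf_sum (map_poly s')).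
apply: eq_bigr => i _; rewrite -[LHS]/(beta _ : {poly A}) betaZ beta_iter.
by rewrite coef_map.
Qed.

HB.instance Definition _ := GRing.isMonoidMorphism.Build ambi_base ambi_base
  (ambi_beta sK s'K) ambi_beta_is_monoid_morphism.

(* The beta-derivation with A |-> 0 and y |-> v; the derivation law forces
   a y^(i+1) |-> s^-1(a) (v + s(v) + ... + s^i(v)) y^i. *)
Definition ambi_delta (p : ambi_base) : ambi_base :=
  \poly_(i < (size (p : {poly A})).-1)
     (s' (p : {poly A})`_i.+1 * \sum_(j < i.+1) iter j s v).

Let D : {poly A} -> {poly A} := ambi_delta.

Let coefD_ p i : (D p)`_i = s' p`_i.+1 * \sum_(j < i.+1) iter j s v.
Proof.
rewrite coef_poly; case: ltnP => // le_pi.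
by rewrite nth_default ?raddf0 ?mul0r // (leq_trans (leqSpred _)).
Qed.

Lemma ambi_delta_is_zmod_morphism : zmod_morphism ambi_delta.
Proof.
move=> p r; apply/(@polyP A) => i.
have -> : (ambi_delta p - ambi_delta r : ambi_base)
    = (D p - D r : {poly A}) by [].
rewrite -[LHS]/((D ((p : {poly A}) - r))`_i) coefB !coefD_ coefB.
by rewrite raddfB mulrBl.
Qed.

HB.instance Definition _ := GRing.isZmodMorphism.Build ambi_base ambi_base
  ambi_delta ambi_delta_is_zmod_morphism.

Let DZ a p : D (a *: p) = s' a *: D p.
Proof. by apply/polyP=> i; rewrite coefZ !coefD_ coefZ rmorphM mulrA. Qed.

Let DT p : D (T p) = T (D p) + v *: p.
Proof.
apply/polyP=> i; rewrite coefD coefZ coefD_ !TE !coefMX /= coef_map /= sK.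
rewrite big_ord_recl /= mulrDr [p`_i * v]mulrC addrC; congr (_ + _).
case: i => [|i] /=; first by rewrite big_ord0 mulr0.
by rewrite coef_map /= coefD_ rmorphM s'K raddf_sum.
Qed.

Lemma ambi_deltaM (p r : ambi_base) :
  ambi_delta (p * r) = beta p * ambi_delta r + ambi_delta p * r.
Proof.
have DXr i : D (iter i T r) = iter i T (D r) + 
      skew_mul (null_skew_derivation s) (D 'X^i) r.
  elim: i => [|i IH].
    have D1 : D 'X^0 = 0.
      by apply/polyP=> j; rewrite coefD_ coef1 coef0 rmorph0 mul0r.
    by rewrite D1 skew_mul0l addr0.
  rewrite /= DT IH -(skew_shiftXn (null_skew_derivation s)) -/T DT.
  by rewrite skew_mulDl -skew_shift_mul skew_mulCXn /T skew_shiftD -[LHS]addrA.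
have Dsum n (F : 'I_n -> {poly A}) : D (\sum_i F i) = \sum_i D (F i).
  exact: (raddf_sum ambi_delta).
have le_bp : (size (beta p : {poly A}) <= size (p : {poly A}))%N.
  exact: size_poly.
have -> : ambi_delta p = \sum_(i < size (p : {poly A}))
    s' (p : {poly A})`_i *: D 'X^i :> {poly A}.
  by rewrite -[LHS]/(D p) -{1}(@coefK A p) poly_def Dsum; apply: eq_bigr => i _; rewrite DZ.
rewrite !mulE skew_mul_suml (skew_mulEw _ _ le_bp) [LHS]Dsum.
rewrite -[RHS](big_split (@GRing.add {poly A})) /=.
by apply: eq_bigr => i _; rewrite DZ DXr scalerDr skew_mulZ coef_map.
Qed.

Definition ambi_derivation : skew_derivation beta :=
  SkewDerivation ambi_deltaM.

(* R(A, s, v, 1) = A[y; s][x; beta, delta] *)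
Definition ambiskew := skew_poly ambi_derivation.

Definition ambi_y0 : ambi_base := skew_polyX (null_skew_derivation s).
Definition ambi_const (a : A) : ambiskew :=
  skew_polyC ambi_derivation (skew_polyC (null_skew_derivation s) a).
Definition ambi_y : ambiskew := skew_polyC ambi_derivation ambi_y0.
Definition ambi_x : ambiskew := skew_polyX ambi_derivation.

HB.instance Definition _ := GRing.RMorphism.copy ambi_const
  (skew_polyC ambi_derivation \o skew_polyC (null_skew_derivation s)).

Lemma ambi_betaC a : beta (skew_polyC _ a) = skew_polyC _ (s' a).
Proof. exact: map_polyC. Qed.

Lemma ambi_betaX : beta ambi_y0 = ambi_y0.
Proof. exact: map_polyX. Qed.

Lemma ambi_deltaC a : ambi_delta (skew_polyC _ a) = 0.
Proof.
by apply/(@polyP A) => i; rewrite [LHS]coefD_ coefC coef0 rmorph0 mul0r.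
Qed.

Lemma ambi_deltaX : ambi_delta ambi_y0 = skew_polyC _ v.
Proof.
apply/(@polyP A) => i; rewrite [LHS]coefD_ coefX coefC.
case: i => [|i]; last by rewrite rmorph0 mul0r.
by rewrite rmorph1 mul1r big_ord1.
Qed.

Lemma ambi_yC a : ambi_y * ambi_const a = ambi_const (s a) * ambi_y.
Proof.
rewrite /ambi_y /ambi_const -!rmorphM skew_polyXC /=; congr skew_polyC.
by rewrite (rmorph0 (skew_polyC _)) addr0.
Qed.

Lemma ambi_xC a : ambi_x * ambi_const a = ambi_const (s' a) * ambi_x.
Proof.
rewrite skew_polyXC /= ambi_betaC ambi_deltaC.
by rewrite (rmorph0 (skew_polyC _)) addr0.
Qed.

Lemma ambi_xy : ambi_x * ambi_y - ambi_y * ambi_x = ambi_const v.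
Proof.
by rewrite skew_polyXC /= ambi_betaX ambi_deltaX addrC addKr.
Qed.

End Ambiskew.

(* {malg K[int]} has no ring structure because int is not a monomType;
   f@_i is the coefficient of k^i in f and << a *g i >> is a k^i. *)
Definition laurent (K : fieldType) : Type := {malg K[int]}.

Section Laurent.
Variable K : fieldType.
Local Notation L := {malg K[int]}.
Implicit Types f g h : L.

Definition laurent_one : L := << 0 >>.
Definition laurent_mul f g : L :=
  \sum_(i <- msupp f) \sum_(j <- msupp g) << f@_i * g@_j *g i + j >>.

Lemma laurent_mulEw (d1 d2 : {fset int}) f g :
  (msupp f `<=` d1)%fset -> (msupp g `<=` d2)%fset ->
  laurent_mul f g = \sum_(i <- d1) \sum_(j <- d2) << f@_i * g@_j *g i + j >>.
Proof.
move=> le1 le2; rewrite /laurent_mul (big_fset_incl _ le1) /=.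
  apply/eq_bigr=> i _; apply/big_fset_incl => // j _ /mcoeff_outdom ->.
  by rewrite mulr0 monalgU0.
move=> i _ /mcoeff_outdom fi.
by rewrite big1 // => j _; rewrite fi mul0r monalgU0.
Qed.

Lemma laurent_mulC : commutative laurent_mul.
Proof.
move=> f g; rewrite /laurent_mul exchange_big; apply: eq_bigr => j _.
by apply: eq_bigr => i _; rewrite mulrC addrC.
Qed.

Lemma laurent_mulDl : left_distributive laurent_mul +%R.
Proof.
move=> f g h; pose d := (msupp f `|` msupp g)%fset.
rewrite !(@laurent_mulEw d (msupp h)) ?fsubsetUl ?fsubsetUr ?fsubset_refl //;
  last exact: msuppD_le.
rewrite -big_split; apply: eq_bigr => i _ /=.
rewrite -big_split; apply: eq_bigr => j _ /=.
by rewrite mcoeffD mulrDl monalgUD.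
Qed.

Lemma laurent_mulDr : right_distributive laurent_mul +%R.
Proof. by move=> f g h; rewrite !(laurent_mulC f) laurent_mulDl. Qed.

Lemma laurent_mul0l f : laurent_mul 0 f = 0.
Proof. by rewrite /laurent_mul msupp0 big_seq_fset0. Qed.

Lemma laurent_mul0r f : laurent_mul f 0 = 0.
Proof. by rewrite laurent_mulC laurent_mul0l. Qed.

Lemma laurent_mulUU a b (i j : int) :
  laurent_mul << a *g i >> << b *g j >> = << a * b *g i + j >>.
Proof.
rewrite (@laurent_mulEw [fset i]%fset [fset j]%fset) ?msuppU_le //.
by rewrite !big_seq_fset1 !mcoeffUU.
Qed.

Lemma laurent_mul_suml (I : Type) (r : seq I) (F : I -> L) g :
  laurent_mul (\sum_(i <- r) F i) g = \sum_(i <- r) laurent_mul (F i) g.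
Proof.
exact: (big_morph (laurent_mul^~ g) (fun f h => laurent_mulDl f h g)
  (laurent_mul0l g)).
Qed.

Lemma laurent_mul_sumr (I : Type) (r : seq I) (F : I -> L) g :
  laurent_mul g (\sum_(i <- r) F i) = \sum_(i <- r) laurent_mul g (F i).
Proof.
exact: (big_morph (laurent_mul g) (laurent_mulDr g) (laurent_mul0r g)).
Qed.

Lemma laurent_mulA : associative laurent_mul.
Proof.
move=> f g h; rewrite [f]monalgE !laurent_mul_suml; apply: eq_bigr => i _.
rewrite [g]monalgE !(laurent_mul_suml, laurent_mul_sumr).
apply: eq_bigr => j _; rewrite [h]monalgE !laurent_mul_sumr.
by apply: eq_bigr => l _; rewrite !laurent_mulUU mulrA addrA.
Qed.

Lemma laurent_mul1l : left_id laurent_one laurent_mul.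
Proof.
move=> f; rewrite {1}[f]monalgE laurent_mul_sumr [RHS]monalgE.
by apply: eq_bigr => i _; rewrite laurent_mulUU mul1r add0r.
Qed.

Lemma laurent_one_neq0 : laurent_one != 0.
Proof. by rewrite monalgU_eq0 oner_eq0. Qed.

HB.instance Definition _ := GRing.Lmodule.copy (laurent K) L.
HB.instance Definition _ := GRing.Zmodule_isComNzRing.Build (laurent K)
  laurent_mulA laurent_mulC laurent_mul1l laurent_mulDl laurent_one_neq0.

(* the substitution k |-> t k *)
Definition laurent_scale (t : K) of t != 0 : laurent K -> laurent K :=
  fun f => [malg i in msupp f => t ^ i * f@_i].

Section Scale.
Variables (t : K) (t0 : t != 0).
Local Notation sc := (laurent_scale t0).

Lemma laurent_scaleE (f : laurent K) i : (sc f)@_i = t ^ i * f@_i.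
Proof. by rewrite mcoeffE; case: msuppP => // _; rewrite mulr0. Qed.

Lemma laurent_scaleU a (i : int) :
  sc (<< a *g i >> : L) = (<< t ^ i * a *g i >> : L).
Proof.
apply/malgP=> j; rewrite laurent_scaleE !mcoeffU.
by case: eqP => [->|]; rewrite ?mulr0.
Qed.

Lemma laurent_scale_is_zmod_morphism : zmod_morphism sc.
Proof.
move=> f g; apply/malgP=> i.
by rewrite mcoeffB !laurent_scaleE mcoeffB mulrBr.
Qed.

HB.instance Definition _ := GRing.isZmodMorphism.Build (laurent K) (laurent K)
  (laurent_scale t0) laurent_scale_is_zmod_morphism.

Lemma laurent_scale_is_monoid_morphism : monoid_morphism sc.
Proof.
split=> [|f g]; first by rewrite [LHS]laurent_scaleU expr0z mul1r.
rewrite -[f * g]/(laurent_mul f g) -[RHS]/(laurent_mul (sc f) (sc g)).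
rewrite [f]monalgE [g]monalgE laurent_mul_suml.
rewrite !(raddf_sum sc) laurent_mul_suml; apply: eq_bigr => i _.
rewrite !laurent_mul_sumr !(raddf_sum sc); apply: eq_bigr => j _.
rewrite laurent_mulUU /= !laurent_scaleU laurent_mulUU expfzDr //.
by rewrite mulrACA.
Qed.

HB.instance Definition _ := GRing.isMonoidMorphism.Build (laurent K) (laurent K)
  (laurent_scale t0) laurent_scale_is_monoid_morphism.
End Scale.

Lemma laurent_scaleK (t t' : K) (t0 : t != 0) (t'0 : t' != 0) :
  t' * t = 1 -> cancel (laurent_scale t0) (laurent_scale t'0).
Proof.
move=> tt' f; apply/malgP=> i.
by rewrite !laurent_scaleE mulrA -exprzMl ?unitfE // tt' exp1rz mul1r.
Qed.

End Laurent.

Section AugmentedDownUp.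
Variables (K : fieldType) (q : K) (q0 : q != 0).

(* A = K[k, k^-1][c], with c = 'X *)
Definition adu_base := {poly laurent K}.

Fact adu_q2_neq0 : q ^+ 2 != 0. Proof. exact: expf_neq0. Qed.
Fact adu_q2V_neq0 : (q ^+ 2)^-1 != 0.
Proof. exact: invr_neq0 adu_q2_neq0. Qed.

Definition adu_alpha : adu_base -> adu_base :=
  map_poly (laurent_scale adu_q2_neq0).
Definition adu_alphaV : adu_base -> adu_base :=
  map_poly (laurent_scale adu_q2V_neq0).

HB.instance Definition _ := GRing.RMorphism.copy adu_alpha
  (map_poly (laurent_scale adu_q2_neq0)).
HB.instance Definition _ := GRing.RMorphism.copy adu_alphaV
  (map_poly (laurent_scale adu_q2V_neq0)).

Lemma adu_alphaK : cancel adu_alpha adu_alphaV.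
Proof.
by move=> p; apply/polyP=> i; rewrite !coef_map /= laurent_scaleK ?mulVf ?adu_q2_neq0.
Qed.

Lemma adu_alphaVK : cancel adu_alphaV adu_alpha.
Proof.
by move=> p; apply/polyP=> i; rewrite !coef_map /= laurent_scaleK ?mulfV ?adu_q2_neq0.
Qed.

Definition laurent_k (i : int) : laurent K := (<< i >> : {malg K[int]}).
Definition adu_k (i : int) : adu_base := (laurent_k i)%:P.
Definition adu_c : adu_base := 'X.
Definition adu_f (f : laurent K) : adu_base := f%:P.

Lemma adu_k0 : adu_k 0 = 1.
Proof. by []. Qed.

Lemma adu_kD i j : adu_k (i + j) = adu_k i * adu_k j.
Proof.
rewrite /adu_k -polyCM; congr polyC.
by rewrite -[RHS]/(laurent_mul _ _) laurent_mulUU mulr1.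
Qed.

Lemma adu_alpha_k i : adu_alpha (adu_k i) = ((q ^+ 2) ^ i *: laurent_k i)%:P.
Proof.
rewrite /adu_alpha map_polyC /= laurent_scaleU; congr polyC.
by apply/malgP=> j; rewrite mcoeffZ !mcoeffU mulrnAr.
Qed.

Lemma adu_alpha_c : adu_alpha adu_c = adu_c.
Proof. exact: map_polyX. Qed.

Lemma adu_alphaZ (a : K) (g : laurent K) :
  adu_alpha (a *: g)%:P = (a *: laurent_scale adu_q2_neq0 g)%:P.
Proof.
rewrite /adu_alpha map_polyC /=; congr polyC.
by apply/malgP=> j; rewrite mcoeffZ !laurent_scaleE mcoeffZ mulrCA.
Qed.

Variables (n : int) (f : laurent K).

Definition adu_u : adu_base := adu_c * adu_k n + adu_f f.
Definition adu_v : adu_base := adu_u - adu_alpha adu_u.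

Lemma adu_vE : adu_v = adu_c * ((1 - (q ^+ 2) ^ n) *: laurent_k n)%:P
  + (\sum_(i <- msupp f) (f@_i * (1 - (q ^+ 2) ^ i)) *: laurent_k i)%:P.
Proof.
rewrite /adu_v /adu_u rmorphD rmorphM /= adu_alpha_c adu_alpha_k.
have -> : adu_alpha (adu_f f) = (laurent_scale adu_q2_neq0 f)%:P.
  exact: map_polyC.
rewrite scalerBl scale1r polyCB mulrBr opprD addrACA; congr (_ + _).
rewrite /adu_f -polyCB; congr polyC; apply/malgP=> j.
rewrite mcoeffB laurent_scaleE (raddf_sum (mcoeff j)) /=.
under eq_bigr => i _ do rewrite mcoeffZ mcoeffU.
case: (msuppP f j) => [jf|jf].
  rewrite (big_fsetD1 j) //= eqxx mulr1 big1_fset => [|i].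
    by rewrite addr0 mulrBr mulr1 mulrC.
  by rewrite in_fsetD1 => /andP[/negPf-> _] _; rewrite mulr0.
rewrite mulr0 subrr big_seq big1 // => i fi.
by case: eqP => [ij|]; rewrite ?mulr0 //; rewrite ij (negPf jf) in fi.
Qed.

Definition augmented_down_up := ambiskew adu_alphaK adu_alphaVK adu_v.

End AugmentedDownUp.

Definition central (R : pzRingType) (z : R) : Prop :=
  forall r : R, GRing.comm z r.

Record two_sided_ideal (R : pzRingType) (I : R -> Prop) : Prop := {
  ideal0 : I 0;
  idealB : forall a b, I a -> I b -> I (a - b);
  idealMl : forall r a, I a -> I (r * a);
  idealMr : forall r a, I a -> I (a * r)
}.

Definition nonzero_ideal (R : pzRingType) (I : R -> Prop) : Prop :=
  exists2 a, I a & a <> 0.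

Definition simple_ring (R : pzRingType) : Prop :=
  1 <> 0 :> R /\
  forall I : R -> Prop, two_sided_ideal I -> nonzero_ideal I -> forall a, I a.

Definition invertible (R : pzRingType) (a : R) : Prop :=
  exists2 b, a * b = 1 & b * a = 1.

(* S is meant to be a multiplicative set of central elements, so that left
   and right fractions coincide. *)
Record is_central_localization (R Q : pzRingType) (S : R -> Prop)
    (phi : {rmorphism R -> Q}) : Prop := {
  loc_inv : forall s, S s -> invertible (phi s);
  loc_frac : forall x, exists r s, S s /\ x * phi s = phi r;
  loc_ker : forall r, phi r = 0 <-> exists2 s, S s & s * r = 0
}.

(* Main.v *)
From HB Require Import structures.
Require Import Defs.
From mathcomp Require Import all_boot all_order all_algebra finmap.
From mathcomp Require Import zify.
From mathcomp.multinomials Require Import monalg.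

(** The element z = x y - u is central, and so are all polynomials in c and z.
Multiplying a non-zero element of an ideal I on the right by a power of x turns
it into a sum of terms b_d x^d with b_d a polynomial in z over A.  As q is not
a root of unity, conjugation by k separates the powers of x, and commutation
with x separates the powers of k, so I contains some p x^N with p a non-zero
polynomial in c and z.  To lower N, multiply p x^(d+1) by y on either side:
this gives p (z + alpha u) x^d and p (z + alpha^-d u) x^d.  Modulo the ideal of
A[z] generated by these two factors, both c and z become Laurent polynomials in
k, hence algebraically dependent over K, and their relation is a polynomial in
c and z that can replace the two factors. *)

Set Implicit Arguments.
Unset Strict Implicit.
Unset Printing Implicit Defensive.

Import GRing.Theory.
Local Open Scope ring_scope.

(** * Two-sided ideals and separation of eigenvectors *)

Section IdealFacts.
Variables (R : nzRingType) (I : R -> Prop).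
Hypothesis II : two_sided_ideal I.

Lemma idealN a : I a -> I (- a).
Proof. by move=> Ia; rewrite -sub0r; apply: idealB Ia => //; exact: ideal0. Qed.

Lemma idealD a b : I a -> I b -> I (a + b).
Proof.
by move=> Ia Ib; rewrite -[b]opprK; apply: idealB => //; exact: idealN.
Qed.

Lemma ideal_sum (T : eqType) (s : seq T) (F : T -> R) :
  (forall t, t \in s -> I (F t)) -> I (\sum_(t <- s) F t).
Proof.
move=> IF; rewrite big_seq.
by elim/big_ind: _ => //; [exact: ideal0 | exact: idealD].
Qed.

(** [T - l a] kills the term at [a] and multiplies every other term by the non-zero scalar
    [l j - l a], which allows induction on [s]. This serves twice: to separate the powers of [x],
    then those of [k]. *)
Lemma ideal_eigen (K : fieldType) (e : {rmorphism K -> R}) (T : R -> R)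
    (t : eqType) (l : t -> K) (s : seq t) (w : t -> R) :
  {morph T : a b / a - b} -> (forall a r, T (e a * r) = e a * T r) ->
  (forall r, I r -> I (T r)) ->
  uniq s -> {in s &, injective l} ->
  (forall i, i \in s -> T (w i) = e (l i) * w i) ->
  I (\sum_(i <- s) w i) -> forall i, i \in s -> I (w i).
Proof.
move=> TB Te IT; have T0 : T 0 = 0 by rewrite -{1}(subrr 0) TB subrr.
have TD a b : T (a + b) = T a + T b.
  have TN c : T (- c) = - T c by rewrite -sub0r TB T0 sub0r.
  by rewrite -[b]opprK TB !TN opprK.
elim: s w => // a s IH w /= /andP[as_ us] linj Tw Iw.
have Is i : i \in s -> I (w i).
  move=> si; have ne : l i - l a != 0.
    rewrite subr_eq0; apply: contra as_ => /eqP/linj <- //;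
    by rewrite inE ?eqxx ?si ?orbT.
  rewrite -[w i]mul1r -(rmorph1 e) -(mulVf ne) rmorphM -mulrA.
  apply: idealMl => //.
  (* The rescaled terms are eigenvectors for the same eigenvalues. *)
  apply: (IH (fun j => e (l j - l a) * w j)) => //.
  - by move=> j j' sj sj'; apply: linj; rewrite inE ?sj ?sj' orbT.
  - move=> j sj; rewrite Te Tw ?inE ?sj ?orbT // !mulrA -!rmorphM.
    by rewrite [l j * _]mulrC.
  - have -> : \sum_(j <- s) e (l j - l a) * w j =
        T (\sum_(j <- a :: s) w j) - e (l a) * \sum_(j <- a :: s) w j.
      rewrite (big_morph T TD T0) mulr_sumr -sumrB big_cons Tw ?inE ?eqxx //.
      rewrite subrr add0r !big_seq; apply: eq_bigr => j sj.
      by rewrite Tw ?inE ?sj ?orbT // rmorphB mulrBl.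
    by apply: idealB => //; [exact: IT | exact: idealMl].
move=> i; rewrite inE => /predU1P[->|]; last exact: Is.
have -> : w a = \sum_(j <- a :: s) w j - \sum_(j <- s) w j.
  by rewrite big_cons addrK.
by apply: idealB => //; exact: ideal_sum.
Qed.

End IdealFacts.

(** * Coefficients of products in a skew polynomial ring *)

Section SkewCoef.
Variables (A : nzRingType) (s : {rmorphism A -> A}) (d : skew_derivation s).

Lemma coef_skew_polyCM a (p : skew_poly d) i :
  (skew_polyC d a * p : {poly A})`_i = a * (p : {poly A})`_i.
Proof. by rewrite -[skew_polyC d a * p]/(skew_mul d a%:P p) skew_mulC coefZ. Qed.

Lemma coef_skew_polyXM (p : skew_poly d) i :
  (skew_polyX d * p : {poly A})`_i =
  (if i is j.+1 then s (p : {poly A})`_j else 0) + d (p : {poly A})`_i.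
Proof.
rewrite -[skew_polyX d * p]/(skew_mul d 'X^1 p) skew_mulXn /= /skew_shift.
by rewrite coefD coefMX !coef_map; case: i => //= i; rewrite coef_map.
Qed.

(** Coefficients stand on the left, so right multiplication by the variable only shifts degrees.
    Hence the variable cancels on the right, both [x] in [R] and [y] in A[y; s]. *)
Lemma mul_skew_polyX (p : skew_poly d) :
  p * skew_polyX d = ((p : {poly A}) * 'X : {poly A}).
Proof.
rewrite -[p * _]/(skew_mul d p 'X) -[in RHS](@coefK _ p) poly_def mulr_suml.
apply: eq_bigr => i _; rewrite -scalerAl -exprSr; congr (_ *: _).
by elim: (val i) => //= j ->; rewrite skew_shiftXn.
Qed.

Lemma mulrX_skew_eq0 (p : skew_poly d) : p * skew_polyX d = 0 -> p = 0.
Proof.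
rewrite mul_skew_polyX => /polyP pX0; apply/(@polyP A) => i.
by have := pX0 i.+1; rewrite coefMX [RHS]coef0 => ->; rewrite [RHS]coef0.
Qed.

End SkewCoef.

(** * The Casimir element z and the subring A[z] *)

Section Casimir.
Variables (A : comNzRingType) (s s' : {rmorphism A -> A}).
Variables (sK : cancel s s') (s'K : cancel s' s) (u v : A).
Hypothesis vE : v = u - s u.

Local Notation R := (ambiskew sK s'K v).
Local Notation iota := (ambi_const sK s'K v).
Local Notation x := (ambi_x sK s'K v).
Local Notation y := (ambi_y sK s'K v).

Lemma ambi_span (r : R) : exists (m n : nat) (a : nat -> nat -> A),
  r = \sum_(i < m) \sum_(j < n) iota (a i j) * y ^+ j * x ^+ i.
Proof.
pose rp : {poly ambi_base s} := r.
pose n := \max_(i < size rp) size ((rp`_i)%R : {poly A}).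
exists (size rp), n, (fun i j => (rp`_i : {poly A})`_j).
rewrite [LHS]skew_polyE; apply: eq_bigr => i _.
rewrite -mulr_suml; congr (_ * _).
rewrite -/rp [X in skew_polyC _ X](skew_polyE rp`_i) rmorph_sum /=.
rewrite (big_ord_widen n (fun j => skew_polyC (ambi_derivation sK s'K v)
     (skew_polyC (null_skew_derivation s) (rp`_i : {poly A})`_j *
      skew_polyX _ ^+ j))); last exact: (leq_bigmax i).
rewrite big_mkcond; apply: eq_bigr => j _ /=.
case: ltnP => [_|le]; first by rewrite rmorphM rmorphXn.
by rewrite nth_default // rmorph0 mul0r.
Qed.

Lemma ambi_central (z : R) : (forall a, GRing.comm z (iota a)) ->
  GRing.comm z x -> GRing.comm z y -> central z.
Proof.
move=> za zx zy r; have [m [n [a ->]]] := ambi_span r.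
apply: commr_sum => i _; apply: commr_sum => j _.
by apply: commrM; [apply: commrM|]; rewrite //; apply: commrX.
Qed.

Definition casimir : R := x * y - iota u.

Lemma casimirE : casimir = y * x - iota (s u).
Proof.
have iv : iota v = iota u - iota (s u) by rewrite -rmorphB -vE.
rewrite /casimir (canRL (subrK _) (ambi_xy sK s'K v)) iv.
by rewrite addrC !addrA addNr add0r addrC.
Qed.

(** Passing [x] or [y] exchanges the two forms x y - u and y x - s(u): for instance x (y x - s(u)) =
    (x y - u) x, because x s(u) = u x. *)
Lemma casimir_central : central casimir.
Proof.
apply: ambi_central => [a||].
- rewrite /GRing.comm /casimir mulrBl mulrBr -!rmorphM [u * a]mulrC /=.
  by rewrite -mulrA ambi_yC mulrA ambi_xC sK mulrA.
- by rewrite /GRing.comm {1}/casimir casimirE mulrBl mulrBr -mulrA ambi_xC sK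
    mulrA.
- by rewrite /GRing.comm {1}casimirE /casimir mulrBl mulrBr ambi_yC mulrA.
Qed.

Definition casimir_eval : {poly A} -> R :=
  horner_morph (fun a => casimir_central (iota a)).

HB.instance Definition _ := GRing.RMorphism.copy casimir_eval
  (horner_morph (fun a => casimir_central (iota a))).

Local Notation Phi := casimir_eval.

Lemma casimir_evalC a : Phi a%:P = iota a.
Proof. exact: horner_morphC. Qed.

Lemma casimir_evalX : Phi 'X = casimir.
Proof. exact: horner_morphX. Qed.

Lemma casimir_eval_const_comm a p : iota a * Phi p = Phi p * iota a.
Proof. by rewrite -casimir_evalC -!rmorphM mulrC. Qed.

Lemma casimir_eval_yx : y * x = Phi ('X + (s u)%:P).
Proof. by rewrite rmorphD /= casimir_evalC casimir_evalX casimirE subrK. Qed.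

Lemma casimir_eval_xy : x * y = Phi ('X + u%:P).
Proof. by rewrite rmorphD /= casimir_evalC casimir_evalX subrK. Qed.

Lemma mulx_casimir_eval p : x * Phi p = Phi (map_poly s' p) * x.
Proof.
elim/poly_ind: p => [|p a IH]; first by rewrite !rmorph0 mulr0 mul0r.
rewrite !(rmorphD, rmorphM) /= map_polyC map_polyX /= !casimir_evalC.
rewrite casimir_evalX.
by rewrite mulrDr mulrDl ambi_xC mulrA IH -!mulrA casimir_central.
Qed.

Lemma muly_casimir_eval p : y * Phi p = Phi (map_poly s p) * y.
Proof.
elim/poly_ind: p => [|p a IH]; first by rewrite !rmorph0 mulr0 mul0r.
rewrite !(rmorphD, rmorphM) /= map_polyC map_polyX /= !casimir_evalC.
rewrite casimir_evalX.
by rewrite mulrDr mulrDl ambi_yC mulrA IH -!mulrA casimir_central.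
Qed.

Lemma mulxn_casimir_eval n p :
  x ^+ n * Phi p = Phi (iter n (map_poly s') p) * x ^+ n.
Proof.
elim: n p => [|n IH] p; first by rewrite mul1r mulr1.
by rewrite exprSr -mulrA mulx_casimir_eval mulrA IH -mulrA -exprSr iterSr.
Qed.

(** By induction y (y^n x^n) x = y p(z) x, where [y] crosses p(z) by applying [s] to its
    coefficients, and y x = z + s(u). *)
Lemma mulyxn n : exists p, y ^+ n * x ^+ n = Phi p.
Proof.
elim: n => [|n [p IH]]; first by exists 1; rewrite mulr1 rmorph1.
exists (map_poly s p * ('X + (s u)%:P)).
rewrite exprS exprSr -mulrA [y ^+ n * _]mulrA IH mulrA muly_casimir_eval.
by rewrite -mulrA casimir_eval_yx rmorphM.
Qed.

(** A monomial a y^j x^i times x^j is a (y^j x^j) x^i, with y^j x^j in A[z]. The exponent [N] can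
    always be raised, so one value serves all monomials of [r]. *)
Lemma casimir_span (r : R) : exists (N m : nat) (b : nat -> {poly A}),
  r * x ^+ N = \sum_(d < m) Phi (b d) * x ^+ d.
Proof.
pose P N (r : R) := exists (m : nat) (b : nat -> {poly A}),
  r * x ^+ N = \sum_(d < m) Phi (b d) * x ^+ d.
have PS r1 N k : P N r1 -> P (N + k)%N r1.
  move=> [m [b def_r]]; exists (m + k)%N,
    (fun d => if (d < k)%N then 0 else b (d - k)%N).
  rewrite exprD mulrA def_r mulr_suml addnC big_split_ord /=.
  rewrite [X in _ = X + _]big1 ?add0r => [|i _]; last first.
    by rewrite /= ltn_ord rmorph0 mul0r.
  apply: eq_bigr => i _; rewrite ltnNge leq_addr /= addKn -mulrA -exprD.
  by rewrite addnC.
have PD N r1 r2 : P N r1 -> P N r2 -> P N (r1 + r2).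
  move=> [m1 [b1 e1]] [m2 [b2 e2]].
  (* Padding with zeros brings both sums to a common length. *)
  pose c m (b : nat -> {poly A}) d := if (d < m)%N then b d else 0.
  exists (maxn m1 m2), (fun d => c m1 b1 d + c m2 b2 d).
  have w m (b : nat -> {poly A}) : (m <= maxn m1 m2)%N ->
      \sum_(d < m) Phi (b d) * x ^+ d =
      \sum_(d < maxn m1 m2) Phi (c m b d) * x ^+ d.
    move=> le; rewrite (big_ord_widen _ (fun d => Phi (b d) * x ^+ d) le).
    rewrite big_mkcond; apply: eq_bigr => i _; rewrite /c.
    by case: ifP; rewrite // rmorph0 mul0r.
  rewrite mulrDl e1 e2 (w m1 b1) ?leq_maxl // (w m2 b2) ?leq_maxr // -big_split.
  by apply: eq_bigr => i _; rewrite rmorphD mulrDl.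
have Psum (m : nat) (F : 'I_m -> R) : (forall i, exists N, P N (F i)) ->
    exists N, P N (\sum_i F i).
  move=> PF; elim/big_ind: _ => [|r1 r2 [N1 P1] [N2 P2]|//].
    by exists 0%N, 0%N, (fun=> 0); rewrite mul0r big_ord0.
  by exists (N1 + N2)%N; apply: PD; [|rewrite addnC]; exact: PS.
suff [N [m [b Eb]]] : exists N, P N r by exists N, m, b.
have [m [n [a ->]]] := ambi_span r.
apply: (Psum) => i; apply: (Psum) => j; have [p Ep] := mulyxn j.
exists j, (i + 1)%N, (fun d => if d == i :> nat then a i j *: p else 0).
rewrite addn1 big_ord_recr /= eqxx big1 ?add0r => [|k _]; last first.
  by rewrite ltn_eqF // rmorph0 mul0r.
by rewrite -mulrA -exprD addnC exprD mulrA -[_ * _ * x ^+ j]mulrA Ep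
  -mul_polyC rmorphM /= casimir_evalC.
Qed.

Lemma mulrX_ambi_eq0 (r : R) N : r * x ^+ N = 0 -> r = 0.
Proof.
elim: N => [|N IH]; first by rewrite mulr1.
by rewrite exprSr mulrA => /mulrX_skew_eq0/IH.
Qed.

(** As z = y x - s(u), the power z^m has degree m in [x] with top coefficient y^m, and smaller
    powers of z stay below that degree. Here [Phi p] is read as a polynomial in [x] over A[y; s]. *)
Lemma casimir_eval_top (p : {poly A}) m : (size p <= m.+1)%N ->
  let r : {poly ambi_base s} := Phi p in
  (forall j, (m < j)%N -> r`_j = 0) /\
  r`_m = skew_polyC _ p`_m * ambi_y0 s ^+ m.
Proof.
elim: m p => [|m IH] p sp /=.
  have -> : Phi p = skew_polyC _ (skew_polyC _ p`_0).
    by rewrite [in LHS](size1_polyC sp) casimir_evalC.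
  by split=> [[|j] // _|]; rewrite /skew_polyC coefC ?eqxx //= mulr1.
(* Horner step p = q X + p_0; centrality of z lets it stand to the left of [Phi q], where
   coefficients are easy to read. *)
pose q := drop_poly 1 p.
have -> : Phi p = (y * x - iota (s u)) * Phi q + iota p`_0.
  have {1}-> : p = q * 'X + (p`_0)%:P.
    by apply/polyP => -[|i]; rewrite coefD coefMX coefC /= ?add0r ?addr0 //
      coef_drop_poly addn1.
  by rewrite rmorphD rmorphM /= casimir_evalC casimir_evalX -casimirE
    -casimir_central.
have sq : (size q <= m.+1)%N by rewrite size_drop_poly leq_subLR.
have [q0 qm] := IH q sq; pose Q : {poly ambi_base s} := Phi q.
have coefE j : ((y * x - iota (s u)) * Phi q + iota p`_0
      : {poly ambi_base s})`_j.+1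
   = ambi_y0 s * (ambi_beta sK s'K Q`_j + ambi_delta s' v Q`_j.+1)
     - skew_polyC _ (s u) * Q`_j.+1.
  rewrite mulrBl -mulrA [in LHS]coefD coefB coefC addr0.
  by rewrite !coef_skew_polyCM coef_skew_polyXM.
split=> [[|j] // mj|]; rewrite coefE.
  rewrite (q0 j) // (q0 j.+1) ?(ltnW mj) //.
  by rewrite !raddf0 mulr0 addr0 mulr0 subr0.
rewrite (q0 m.+1) // raddf0 mulr0 subr0 addr0 qm rmorphM rmorphXn /=.
rewrite ambi_betaC ambi_betaX.
by rewrite mulrA skew_polyXC /= s'K (rmorph0 (skew_polyC _)) addr0
  coef_drop_poly addn1 -mulrA -exprS.
Qed.

(** The top coefficient in [x] is the leading coefficient of [p] times a power of [y], and [y]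
    cancels on the right. Thus z is transcendental over A. *)
Lemma casimir_eval_eq0 p : Phi p = 0 -> p = 0.
Proof.
move=> p0; apply/eqP; rewrite -lead_coef_eq0; apply/eqP.
have [_] := casimir_eval_top (leqSpred (size p)).
rewrite p0 [X in X = _]coef0 -lead_coefE => /esym.
elim: (size p).-1 => [|m IH]; last by rewrite exprSr mulrA => /mulrX_skew_eq0.
by rewrite mulr1 => /(@polyC_inj A).
Qed.

Lemma casimir_eval_central (e : {poly A}) :
  map_poly s e = e -> map_poly s' e = e -> central (Phi e).
Proof.
move=> se s'e; apply: ambi_central => [a||].
- by rewrite /GRing.comm casimir_eval_const_comm.
- by rewrite /GRing.comm mulx_casimir_eval s'e.
- by rewrite /GRing.comm muly_casimir_eval se.
Qed.

Lemma mulxn_const n a : x ^+ n * iota a = iota (iter n s' a) * x ^+ n.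
Proof.
elim: n a => [|n IH] a; first by rewrite mul1r mulr1.
by rewrite exprSr -mulrA ambi_xC mulrA IH -mulrA iterSr.
Qed.

(** With a = k and a' = k^-1 this makes p(z) x^d an eigenvector of conjugation by k. *)
Lemma casimir_eval_conj (a a' c : A) p d : a' * iter d s' a = c ->
  iota a' * (Phi p * x ^+ d) * iota a = Phi c%:P * (Phi p * x ^+ d).
Proof.
move=> <-; rewrite casimir_evalC rmorphM mulrA casimir_eval_const_comm -!mulrA.
by rewrite mulxn_const [iota _ * (Phi p * _)]mulrA casimir_eval_const_comm
  !mulrA casimir_eval_const_comm.
Qed.

Section Ideal.
Variables (I : R -> Prop) (II : two_sided_ideal I).

(** The two members of [J] come from y e x^(d+1) = e (y x) x^d, as [y] crosses [e] unchanged, and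
    from e x^(d+1) y = e x^d (x y), where moving x y = z + u across x^d applies [s'] d times. *)
Lemma ideal_casimir_lower (e : {poly A}) d : map_poly s e = e ->
  I (Phi e * x ^+ d.+1) ->
  let J b := I (Phi (e * b) * x ^+ d) in
  [/\ two_sided_ideal J, J ('X + (s u)%:P) & J ('X + (iter d s' u)%:P)].
Proof.
move=> se Ie; split.
- split=> [|a b Ja Jb|r a Ja|r a Ja].
  + by rewrite mulr0 rmorph0 mul0r; exact: ideal0.
  + by rewrite mulrBr rmorphB mulrBl; exact: idealB.
  + by rewrite mulrCA rmorphM -mulrA; exact: idealMl.
  + by rewrite mulrA mulrC rmorphM -mulrA; exact: idealMl.
- rewrite rmorphM /= -casimir_eval_yx -mulrA -[y * x * _]mulrA -exprS mulrA.
  by rewrite -{1}se -muly_casimir_eval -mulrA; exact: idealMl.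
have -> : 'X + (iter d s' u)%:P = iter d (map_poly s') ('X + u%:P).
  by elim: d {Ie} => //= d <-; rewrite rmorphD /= map_polyX map_polyC.
rewrite rmorphM /= -mulrA -mulxn_casimir_eval -casimir_eval_xy !mulrA.
by rewrite -[Phi e * _ * x]mulrA -exprSr; exact: Defs.idealMr.
Qed.

(** Letting [N] vary gives stability under [s'], since x b x^N = s'(b) x^(N+1); two members reach a
    common exponent through right multiplication by powers of [x]. *)
Lemma ideal_casimir_eval :
  let J b := exists N, I (Phi b * x ^+ N) in
  two_sided_ideal J /\ (forall b, J b -> J (map_poly s' b)).
Proof.
split=> [|b [N Ib]]; last first.
  by exists N.+1; rewrite exprS mulrA -mulx_casimir_eval -mulrA; exact: idealMl.
have up b N k : I (Phi b * x ^+ N) -> I (Phi b * x ^+ (N + k)).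
  by move=> Ib; rewrite exprD mulrA; exact: Defs.idealMr.
split=> [|a b [N Ia] [M Ib]|r a [N Ia]|r a [N Ia]].
- by exists 0%N; rewrite rmorph0 mul0r; exact: ideal0.
- exists (N + M)%N; rewrite rmorphB mulrBl; apply: idealB => //.
    exact: up.
  by rewrite addnC; exact: up.
- by exists N; rewrite rmorphM -mulrA; exact: idealMl.
- by exists N; rewrite mulrC rmorphM -mulrA; exact: idealMl.
Qed.

End Ideal.
End Casimir.


(** * Algebraic dependence of two Laurent polynomials *)

Section LaurentDependence.
Variable K : fieldType.
Local Notation L := (laurent K).

Definition laurent_const (a : K) : L := (<< a *g 0 >> : {malg K[int]}).

Lemma laurent_const_mul (a : K) (f : L) : laurent_const a * f = a *: f.
Proof.
rewrite -[LHS]/(laurent_mul (laurent_const a) f) {1}[f]monalgE laurent_mul_sumr.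
rewrite [in RHS](monalgE f) scaler_sumr; apply: eq_bigr => i _.
rewrite laurent_mulUU add0r; apply/malgP => j.
by rewrite mcoeffZ !mcoeffU mulrnAr.
Qed.

Lemma laurent_const_is_zmod_morphism : zmod_morphism laurent_const.
Proof. by move=> a b; apply/malgP => j; rewrite mcoeffB !mcoeffU mulrnBl. Qed.

Lemma laurent_const_is_monoid_morphism : monoid_morphism laurent_const.
Proof.
by split=> // a b; rewrite laurent_const_mul; apply/malgP => j;
  rewrite mcoeffZ !mcoeffU mulrnAr.
Qed.

HB.instance Definition _ := GRing.isZmodMorphism.Build K L
  laurent_const laurent_const_is_zmod_morphism.
HB.instance Definition _ := GRing.isMonoidMorphism.Build K L
  laurent_const laurent_const_is_monoid_morphism.

Lemma laurent_const_inj : injective laurent_const.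
Proof. by move=> a b /(congr1 (mcoeff 0)); rewrite !mcoeffUU. Qed.

Definition degree_le (D : nat) (f : L) :=
  forall i : int, (D < `|i|)%N -> f@_i = 0.

Lemma degree_leP (f : L) : exists D, degree_le D f.
Proof.
exists (\max_(i <- msupp f) `|i|)%N => i lt_i; apply/eqP; rewrite mcoeff_eq0.
apply: contraL lt_i => fi; rewrite -leqNgt.
exact: (@leq_bigmax_seq _ (enum_fset (msupp f)) xpredT (fun i : int => `|i|%N) i).
Qed.

Lemma degree_leW D D' f : (D <= D')%N -> degree_le D f -> degree_le D' f.
Proof. by move=> DD' fD i Di; apply: fD; apply: leq_ltn_trans Di. Qed.

Lemma degree_le1 : degree_le 0 1.
Proof.
by move=> i i0; rewrite mcoeffU -[0 == i]negbK eq_sym -absz_gt0 i0.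
Qed.

Lemma degree_leM D D' f g :
  degree_le D f -> degree_le D' g -> degree_le (D + D') (f * g).
Proof.
move=> fD gD i lt_i; rewrite -[f * g]/(laurent_mul f g) /laurent_mul.
rewrite (raddf_sum (mcoeff i)) big1 // => j _.
rewrite (raddf_sum (mcoeff i)) big1 // => l _ /=.
rewrite mcoeffU; case: eqP => [ij|]; last by rewrite mulr0n.
have [/fD->|jD] := ltnP D `|j|%N; first by rewrite mul0r mul0rn.
have [/gD->|lD] := ltnP D' `|l|%N; first by rewrite mulr0 mul0rn.
lia.
Qed.

Lemma degree_leX D f n : degree_le D f -> degree_le (n * D) (f ^+ n).
Proof.
move=> fD; elim: n => [|n IH]; first exact: degree_le1.
by rewrite exprS mulSn; apply: degree_leM.
Qed.

(** The exponents lie in the window from -D to D, so the [w t] live in a space of dimension 2D +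
    1. *)
Lemma laurent_dependent (T : finType) (D : nat) (w : T -> L) :
  (D.*2.+1 < #|T|)%N -> (forall t, degree_le D (w t)) ->
  exists2 a : T -> K, \sum_t a t *: w t = 0 & exists t, a t != 0.
Proof.
move=> ltD wD.
(* Column j records the coefficient of k^(j - D); a left kernel vector is a linear relation. *)
pose A : 'M[K]_(#|T|, D.*2.+1) := \matrix_(i, j) (w (enum_val i))@_(j%:Z - D%:Z).
have : kermx A != 0.
  by rewrite kermx_eq0 -row_leq_rank -ltnNge (leq_ltn_trans (rank_leq_col A)).
move=> /rowV0Pn[v /sub_kermxP vA v0].
exists (fun t => v 0 (enum_rank t)); last first.
  have [i vi] : exists i, v 0 i != 0.
    apply/existsP; apply: contra_neqT v0 => /existsPn vi.
    by apply/rowP => i; rewrite mxE; apply/eqP/negPn/vi.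
  by exists (enum_val i); rewrite enum_valK.
apply/malgP => i; rewrite mcoeff0 (raddf_sum (mcoeff i)) /=.
have [lt_i|le_i] := ltnP D `|i|%N.
  by rewrite big1 // => t _; rewrite mcoeffZ (wD t i lt_i) mulr0.
have lt_j : (`|(i + D%:Z)%R| < D.*2.+1)%N by lia.
move/rowP/(_ (Ordinal lt_j)): vA; rewrite !mxE => e; rewrite -[RHS]e {e}.
rewrite (reindex_onto enum_val enum_rank) /=; last first.
  by move=> t _; exact: enum_rankK.
apply: eq_big => [j|j _]; first by rewrite enum_valK eqxx.
rewrite !mxE enum_valK mcoeffZ /=; congr (_ * mcoeff _ _); lia.
Qed.

(** There are N^2 products g^i h^j with i, j < N, while their exponents grow only linearly in N. The
    inner variable of [P] stands for [g], the outer one for [h]. *)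
Lemma laurent_algebraic (g h : L) : exists2 P : {poly {poly K}},
  P != 0 & (map_poly (map_poly laurent_const) P).[h%:P].[g] = 0.
Proof.
have [D1 gD] := degree_leP g; have [D2 hD] := degree_leP h.
(* Exponents are at most 2NM in absolute value, and N^2 = 4NM + 2N exceeds the dimension 4NM + 1. *)
pose M := maxn D1 D2; pose N := (4 * M + 2)%N.
have [||a a0 [[i0 j0] aij]] := @laurent_dependent ('I_N * 'I_N)%type (N * M * 2)
  (fun t => g ^+ t.1 * h ^+ t.2).
- by rewrite card_prod card_ord; lia.
- move=> [i j] /=; apply: (@degree_leW (i * D1 + j * D2)).
    by have := ltn_ord i; have := ltn_ord j; rewrite /M; nia.
  by apply: degree_leM; apply: degree_leX.
exists (\sum_(j < N) (\sum_(i < N) (a (i, j))%:P * 'X^i)%:P * 'X^j).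
  apply: contra_neq aij => /(congr1 (fun p : {poly {poly K}} => p`_j0`_i0)).
  rewrite coef0 coef0 coef_sum (bigD1 j0) //= coefCM coefXn eqxx mulr1
    [X in _ + X]big1 ?addr0.
    rewrite coef_sum (bigD1 i0) //= coefCM coefXn eqxx mulr1
      big1 ?addr0 // => i ne.
    by rewrite coefCM coefXn eq_sym [_ == _](negPf ne) mulr0.
  by move=> j ne; rewrite coefCM coefXn eq_sym [_ == _](negPf ne) mulr0.
transitivity (\sum_(i < N) \sum_(j < N) a (i, j) *: (g ^+ i * h ^+ j));
  last first.
  by rewrite pair_bigA -[RHS]a0; apply: eq_bigr => -[].
rewrite exchange_big /= rmorph_sum !horner_sum; apply: eq_bigr => j _ /=.
rewrite rmorphM /= map_polyC map_polyXn !hornerM hornerC hornerXn /=.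
rewrite -polyC_exp hornerC rmorph_sum horner_sum mulr_suml.
apply: eq_bigr => i _ /=.
rewrite rmorphM /= map_polyC map_polyXn hornerM hornerC hornerXn.
by rewrite -mulrA laurent_const_mul.
Qed.

End LaurentDependence.


(** * Ideals of A[z] and polynomials in c and z *)

Lemma ideal_sub_horner (A : comNzRingType) (J : {poly A} -> Prop) (a : A) p :
  two_sided_ideal J -> J ('X - a%:P) -> J (p - p.[a]%:P).
Proof.
move=> JJ Ja; have : root (p - p.[a]%:P) a.
  by rewrite /root hornerD hornerN hornerC subrr.
by move=> /factor_theorem[q ->]; exact: idealMl.
Qed.

(** The maximum of finitely many bounds works, and [P 0 0] covers the coefficients past the size.
    Nested use bounds the exponents of k throughout an element of A[z]. *)
Lemma poly_uniform_bound (A : nzSemiRingType) (P : nat -> A -> Prop) :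
  P 0 0 -> (forall D D' a, (D <= D')%N -> P D a -> P D' a) ->
  (forall a, exists D, P D a) ->
  forall p : {poly A}, exists D, forall i, P D p`_i.
Proof.
move=> P0 PW Pex p.
have [D PD] : exists D : 'I_(size p) -> nat, forall i, P (D i) p`_i.
  exact: (@fin_all_exists _ (fun=> nat) (fun (i : 'I_(size p)) D => P D p`_i)
    (fun i => Pex _)).
exists (\max_i D i)%N => i; have [lt_i|le_i] := ltnP i (size p).
  exact: (PW _ _ _ (leq_bigmax (Ordinal lt_i)) (PD _)).
by rewrite nth_default //; exact: PW (leq0n _) P0.
Qed.

Section CentralPolynomials.
Variable K : fieldType.
Local Notation L := (laurent K).
Local Notation B := {poly {poly L}}.

(* The inclusion of K[c][z] in A[z], where A = K[k, k^-1][c]. *)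
Definition const_poly : {poly {poly K}} -> B :=
  map_poly (map_poly (@laurent_const K)).

HB.instance Definition _ := GRing.RMorphism.copy const_poly
  (map_poly (map_poly (@laurent_const K))).

Lemma coef_const_poly P i j : (const_poly P)`_i`_j = laurent_const P`_i`_j.
Proof. by rewrite coef_map coef_map. Qed.

Lemma const_poly_eq0 P : const_poly P = 0 -> P = 0.
Proof.
move=> P0; apply/polyP => i; apply/polyP => j; apply: laurent_const_inj.
by rewrite -coef_const_poly P0 !coef0 rmorph0.
Qed.

Lemma laurent_kM i j : laurent_k K i * laurent_k K j = laurent_k K (i + j).
Proof. by rewrite -[LHS]/(laurent_mul _ _) laurent_mulUU mulr1. Qed.

Lemma laurent_kNM i : laurent_k K (- i) * laurent_k K i = 1.
Proof. by rewrite laurent_kM addNr. Qed.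

(** The difference of the two members is (t1 - t2) k^n c + f1 - f2, where c has a unit coefficient.
    So modulo [J] both c and z are congruent to Laurent polynomials g and h in k, and a relation
    P(g, h) = 0 puts P(c, z) in [J]. *)
Lemma ideal_linear_pair (J : B -> Prop) (n : int) (t1 t2 : K) (f1 f2 : L)
    (u1 u2 : {poly L}) :
  u1 = 'X * (t1 *: laurent_k K n)%:P + f1%:P ->
  u2 = 'X * (t2 *: laurent_k K n)%:P + f2%:P -> t1 != t2 ->
  two_sided_ideal J -> J ('X + u1%:P) -> J ('X + u2%:P) ->
  exists2 P, P != 0 & J (const_poly P).
Proof.
move=> Eu1 Eu2 t12 JJ J1 J2.
have subDD (A : zmodType) (a b c : A) : b - c = (a + b) - (a + c).
  by rewrite opprD addrACA subrr add0r.
(* [J'] is the contraction of [J] to A, where c is eliminated. *)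
pose J' p := J p%:P.
have JJ' : two_sided_ideal J'.
  split=> [|a b Ja Jb|r a Ja|r a Ja]; rewrite /J'.
  - by rewrite polyC0; exact: ideal0.
  - by rewrite polyCB; exact: idealB.
  - by rewrite polyCM; exact: idealMl.
  - by rewrite polyCM; exact: Defs.idealMr.
have Ju : J' (u1 - u2).
  rewrite /J'; rewrite polyCB (subDD _ 'X); exact: idealB.
(* [w] is the inverse of (t1 - t2) k^n. *)
pose w : L := laurent_const (t1 - t2)^-1 * laurent_k K (- n).
pose g := - (w * (f1 - f2)).
have Jg : J' ('X - g%:P).
  have -> : 'X - g%:P = w%:P * (u1 - u2); last exact: idealMl.
  rewrite Eu1 Eu2 opprD addrACA -mulrBr -!polyCB -scalerBl mulrDr.
  rewrite /g polyCN opprK -polyCM; congr (_ + _).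
  rewrite mulrCA -polyCM -[_ *: _]laurent_const_mul /w mulrACA -rmorphM.
  by rewrite mulVf ?subr_eq0 // rmorph1 mul1r laurent_kNM mulr1.
(* Modulo [J], z is -u1, in which c becomes g. *)
pose h := - u1.[g].
have Jh : J ('X - h%:P%:P).
  have -> : 'X - h%:P%:P = ('X + u1%:P) - (u1 - u1.[g]%:P)%:P.
    by rewrite /h !polyCN polyCB opprK opprB addrA addrAC addrK.
  exact: (idealB JJ J1 (ideal_sub_horner u1 JJ' Jg)).
have [P P0 Pgh] := laurent_algebraic g h; exists P => //.
(* Division by z - h, then by c - g, leaves the remainder P(g, h) = 0. *)
have JP1 := ideal_sub_horner (const_poly P) JJ Jh.
have := ideal_sub_horner (const_poly P).[h%:P] JJ' Jg.
rewrite Pgh subr0 => JP2.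
by rewrite -(subrK (const_poly P).[h%:P]%:P (const_poly P));
  exact: (idealD JJ JP1 JP2).
Qed.

(** The powers of k generate A[z] over K[c][z]; a uniform bound D on the exponents in [b] leaves
    only those from -D to D. *)
Lemma const_poly_span (b : B) : exists (s : seq int) (p : int -> {poly {poly K}}),
  uniq s /\ b = \sum_(i <- s) const_poly (p i) * (laurent_k K i)%:P%:P.
Proof.
have [D bD] : exists D, forall i j, degree_le D b`_i`_j.
  apply: (@poly_uniform_bound _
    (fun D (p : {poly L}) => forall j, degree_le D p`_j)).
  - by move=> j i _; rewrite coef0 mcoeff0.
  - by move=> D D' p DD' pD j; exact: degree_leW (pD j).
  - apply: poly_uniform_bound => [i _||]; [exact: mcoeff0| |exact: degree_leP].
    by move=> D D' a; exact: degree_leW.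
pose s := [seq j%:Z - D%:Z | j <- iota 0 D.*2.+1].
exists s, (fun i => \poly_(m < size b) \poly_(l < size b`_m) (b`_m`_l)@_i).
have us : uniq s by rewrite map_inj_uniq ?iota_uniq // => i j; lia.
split=> //; apply/polyP => m; apply/polyP => l; apply/malgP => j.
rewrite !coef_sum (raddf_sum (mcoeff j)) /=.
under eq_bigr => i _.
  rewrite coefMC coefMC coef_const_poly laurent_const_mul mcoeffZ mcoeffU.
  have -> : (\poly_(m0 < size b)
      \poly_(l0 < size b`_m0) (b`_m0`_l0)@_i)`_m`_l = (b`_m`_l)@_i.
    rewrite coef_poly; case: ltnP => [_|le]; last first.
      by rewrite [b`_m]nth_default ?coef0 ?mcoeff0.
    rewrite coef_poly; case: ltnP => // le.
    by rewrite [_`_l]nth_default ?mcoeff0.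
  over.
have [js|js] := boolP (j \in s).
  rewrite (bigD1_seq j) //= eqxx mulr1 big1 ?addr0 // => i /negPf ne.
  by rewrite ne mulr0.
rewrite big_seq big1 => [|i si]; last first.
  by case: eqP => [ij|]; rewrite ?mulr0 //; rewrite ij (negPf js) in si.
apply: bD; rewrite ltnNge; apply: contra js => le.
apply/mapP; exists `|(j + D%:Z)%R|%N; rewrite ?mem_iota; lia.
Qed.

End CentralPolynomials.


(** * Ideals of A[z] stable under scaling k *)

Section Scaling.
Variables (K : fieldType) (t : K) (t0 : t != 0).
Local Notation L := (laurent K).
Local Notation sc := (laurent_scale t0).

Lemma laurent_scale_k i :
  sc (laurent_k K i) = laurent_const (t ^ i) * laurent_k K i.
Proof.
rewrite laurent_const_mul [LHS]laurent_scaleU; apply/malgP => j.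
by rewrite mcoeffZ !mcoeffU mulrnAr.
Qed.

Lemma laurent_scale_const a : sc (laurent_const a) = laurent_const a.
Proof. by rewrite [LHS]laurent_scaleU expr0z mul1r. Qed.

Lemma laurent_scaleZk a i :
  sc (a *: laurent_k K i) = (a * t ^ i) *: laurent_k K i.
Proof.
by rewrite -!laurent_const_mul !rmorphM /= laurent_scale_const laurent_scale_k
  mulrA.
Qed.

Lemma map_scale_const_poly P :
  map_poly (map_poly sc) (const_poly P) = const_poly P.
Proof.
apply/polyP => i; apply/polyP => j; rewrite coef_map coef_map coef_const_poly.
exact: laurent_scale_const.
Qed.

Definition base_const : K -> {poly {poly L}} :=
  polyC \o polyC \o @laurent_const K.

HB.instance Definition _ := GRing.RMorphism.copy base_const
  (polyC \o polyC \o @laurent_const K).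

Lemma map_scale_base_const a :
  map_poly (map_poly sc) (base_const a) = base_const a.
Proof.
by rewrite /base_const /= map_polyC /= map_polyC /= laurent_scale_const.
Qed.

(** Each component p_i(c, z) k^i is an eigenvector of k |-> t k for t^i, and these eigenvalues are
    distinct, so [J] contains every component of [b]. *)
Lemma ideal_scale_stable (J : {poly {poly L}} -> Prop) :
  injective (fun i : int => t ^ i) -> two_sided_ideal J -> nonzero_ideal J ->
  (forall b, J b -> J (map_poly (map_poly sc) b)) ->
  exists2 P, P != 0 & J (const_poly P).
Proof.
move=> tinj JJ [b Jb b0] Jsc; have [s [p [us def_b]]] := const_poly_span b.
have Jp i : i \in s -> J (const_poly (p i) * (laurent_k K i)%:P%:P).
  apply: (@ideal_eigen _ J JJ K base_const (map_poly (map_poly sc)) _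
    (fun i : int => t ^ i) s
    (fun i => const_poly (p i) * (laurent_k K i)%:P%:P)) => //.
  - exact: (rmorphB (map_poly (map_poly sc))).
  - by move=> a r; rewrite rmorphM /= map_scale_base_const.
  - by move=> i1 i2 _ _ /tinj.
  - move=> j _; rewrite rmorphM /= map_scale_const_poly map_polyC /= map_polyC /=.
    by rewrite laurent_scale_k !polyCM mulrCA.
  - by rewrite -def_b.
have [/hasP[i si pi]|/hasPn p0] := boolP (has (fun i => p i != 0) s).
  exists (p i) => //.
  (* The unit k^i is cancelled. *)
  rewrite -[const_poly _]mulr1 -(polyC1 {poly L}) -(polyC1 L) -(laurent_kNM K i).
  by rewrite !polyCM [X in _ * X]mulrC mulrA;
    exact: (Defs.idealMr JJ _ (Jp i si)).
case: b0; rewrite def_b big_seq big1 // => i /p0/negPn/eqP ->.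
by rewrite rmorph0 mul0r.
Qed.
End Scaling.

(** * Ideals of the augmented down-up algebra *)

Section DownUp.
Variables (K : fieldType) (q : K) (q0 : q != 0).
Hypothesis q_not_root : forall m : nat, (0 < m)%N -> q ^+ m != 1.
Variables (n : int) (n0 : n != 0) (f : laurent K).

Local Notation L := (laurent K).
Local Notation B := {poly {poly L}}.
Local Notation alpha := (adu_alpha q0).
Local Notation alphaV := (adu_alphaV q0).
Local Notation u := (adu_u n f).
Local Notation v := (adu_v q0 n f).
Local Notation sK := (adu_alphaK q0).
Local Notation s'K := (adu_alphaVK q0).
Local Notation R := (ambiskew sK s'K v).
Local Notation iota := (ambi_const sK s'K v).
Local Notation x := (ambi_x sK s'K v).
Local Notation Phi := (casimir_eval sK s'K (erefl v)).

(** This provides the distinct eigenvalues, both for conjugation by k and for alpha^-1. *)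
Lemma expz_sqrV_inj : injective (fun i : int => (q ^+ 2)^-1 ^ i).
Proof.
have qV0 := adu_q2V_neq0 q0.
have one (i : int) : (q ^+ 2)^-1 ^ i = 1 -> i = 0.
  have one_nat (m : nat) : (q ^+ 2)^-1 ^+ m = 1 -> m = 0%N.
    move/eqP; rewrite exprVn -exprM invr_eq1; apply: contraTeq => m0.
    by apply: q_not_root; rewrite muln_gt0 /= lt0n.
  case: i => m; first by move=> /one_nat ->.
  rewrite -[_ ^ Negz m]/(((q ^+ 2)^-1 ^+ m.+1)^-1) => /eqP.
  by rewrite invr_eq1 => /eqP/one_nat.
move=> i j /= ij; apply/eqP; rewrite -subr_eq0; apply/eqP/one.
by rewrite expfzDr // ij -expfzDr // subrr.
Qed.

(** Only the coefficient of c matters later, so the part free of c is left as an unspecified [g]. *)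
Lemma iter_alphaV_u d : exists g : L,
  iter d alphaV u = 'X * ((((q ^+ 2)^-1 ^ n) ^+ d) *: laurent_k K n)%:P + g%:P.
Proof.
elim: d => [|d [g IH]]; first by exists f; rewrite scale1r.
exists (laurent_scale (adu_q2V_neq0 q0) g); rewrite iterS IH.
rewrite rmorphD rmorphM /= /adu_alphaV map_polyX map_polyC /= map_polyC /=.
by rewrite laurent_scaleZk -exprSr; congr (_ + _).
Qed.

Lemma iter_alphaV_k d :
  iter d alphaV (adu_k K 1) =
    (laurent_const ((q ^+ 2)^-1 ^ d) * laurent_k K 1)%:P.
Proof.
elim: d => [|d IH]; first by rewrite rmorph1 mul1r.
rewrite iterS IH /adu_alphaV /= map_polyC /=; congr polyC.
by rewrite !laurent_const_mul laurent_scaleZk expr1z -exprnP -exprSr.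
Qed.

Lemma alpha_u : exists g : L,
  alpha u = 'X * ((q ^+ 2) ^ n *: laurent_k K n)%:P + g%:P.
Proof.
exists (laurent_scale (adu_q2_neq0 q0) f).
rewrite rmorphD rmorphM /= {1}/adu_alpha map_polyX adu_alpha_k.
by rewrite /adu_alpha /adu_f map_polyC.
Qed.

Lemma ideal_central_lower (I : R -> Prop) : two_sided_ideal I ->
  forall N (P : {poly {poly K}}), P != 0 ->
  I (Phi (const_poly P) * x ^+ N) ->
  exists2 P' : {poly {poly K}}, P' != 0 & I (Phi (const_poly P')).
Proof.
move=> II; elim=> [|d IH] P P0; first by rewrite mulr1; exists P.
move=> /ideal_casimir_lower -/(_ II (map_scale_const_poly _ _)) [JJ J1 J2].
have [f1 E1] := alpha_u; have [f2 E2] := iter_alphaV_u d.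
have t12 : (q ^+ 2) ^ n != ((q ^+ 2)^-1 ^ n) ^+ d.
  (* Both sides are powers of q^-2, with exponents -n and n d; equality would force n (d + 1) =
     0. *)
  rewrite -[q ^+ 2]invrK exprz_inv exprnP exprz_exp invrK.
  apply/eqP => /expz_sqrV_inj; move/eqP: n0; nia.
have [P' P'0 IP'] := ideal_linear_pair E1 E2 t12 JJ J1 J2.
(* Membership of P' in the lowered ideal says that P P' x^d lies in [I]. *)
apply: (IH (P * P')); first by rewrite mulf_neq0.
by rewrite (rmorphM (@const_poly K)).
Qed.

Lemma ideal_meets_center (I : R -> Prop) : two_sided_ideal I ->
  nonzero_ideal I -> exists z : R, [/\ I z, central z & z <> 0].
Proof.
move=> II [r Ir r0].
suff [P P0 IP] : exists2 P : {poly {poly K}}, P != 0 & I (Phi (const_poly P)).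
  exists (Phi (const_poly P)); split=> //.
    by apply: casimir_eval_central; exact: map_scale_const_poly.
  by move/casimir_eval_eq0/const_poly_eq0 => P0'; rewrite P0' eqxx in P0.
have [N [m [b Eb]]] := casimir_span (erefl v) r.
have Irx : I (r * x ^+ N) by exact: Defs.idealMr.
have rx0 : r * x ^+ N <> 0 by move/mulrX_ambi_eq0.
have [JJ Jsc] := ideal_casimir_eval (erefl v) II.
(* The term in x^d has eigenvalue q^(-2d) under r |-> k^-1 r k. *)
have Iw d : (d < m)%N -> I (Phi (b d) * x ^+ d).
  move=> dm.
  have iota_comm := casimir_eval_const_comm sK s'K (erefl v).
  pose e : {rmorphism K -> R} := (Phi \o @base_const K)%FUN.
  apply: (@ideal_eigen _ I II K e
    (fun r => iota (adu_k K (-1)) * r * iota (adu_k K 1)) _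
    (fun i : 'I_m => (q ^+ 2)^-1 ^ i) (index_enum 'I_m)
    (fun i => Phi (b i) * x ^+ i) _ _ _ _ _ _ _ (Ordinal dm)).
  - by move=> r1 r2; rewrite mulrBr mulrBl.
  - by move=> a r1; rewrite !mulrA iota_comm.
  - by move=> r1 Ir1; apply: Defs.idealMr => //; exact: idealMl.
  - exact: index_enum_uniq.
  - by move=> i j _ _ /expz_sqrV_inj [] /val_inj.
  - move=> i _; apply: casimir_eval_conj.
    rewrite iter_alphaV_k /adu_k -polyCM; congr polyC.
    by rewrite mulrCA laurent_kNM mulr1.
  - by rewrite -Eb.
  - exact: mem_index_enum.
have [P P0 [M IP]] :
    exists2 P, P != 0 & exists N, I (Phi (const_poly P) * x ^+ N).
  apply: (ideal_scale_stable (t0 := adu_q2V_neq0 q0) expz_sqrV_inj JJ _ Jsc).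
  (* Some [b d] is non-zero, as otherwise r x^N would vanish. *)
  have [/existsP[d bd]|/existsPn b0] := boolP [exists d : 'I_m, b d != 0].
    by exists (b d); [exists d; exact: Iw | exact/eqP].
  case: rx0; rewrite Eb big1 // => d _.
  by rewrite (eqP (negPn (b0 d))) rmorph0 mul0r.
exact: ideal_central_lower IP.
Qed.
End DownUp.

(** * Simplicity of the central localization *)

(** The preimage in [R] of a non-zero ideal contains the numerator of a non-zero fraction, hence a
    non-zero central element, whose image is a unit of [Q]. *)
Lemma central_localization_simple (R : nzRingType) (Q : pzRingType)
    (phi : {rmorphism R -> Q}) :
  (forall I : R -> Prop, two_sided_ideal I -> nonzero_ideal I ->
     exists z : R, [/\ I z, central z & z <> 0]) ->
  is_central_localization (fun z : R => central z /\ z <> 0) phi ->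
  simple_ring Q.
Proof.
move=> Icent [inv frac ker]; split=> [one0|J JJ [a Ja a0]].
  (* If 1 = 0 in [Q], some non-zero s satisfies s 1 = 0 in [R]. *)
  have /ker[s [_ s0]] : phi 1 = 0 by rewrite rmorph1.
  by rewrite mulr1.
have [r [s [Ss as_]]] := frac a.
have [t st ts] := inv _ Ss.
have [||z [Jz zc z0]] := Icent (fun r => J (phi r)).
- split=> [|r1 r2 J1 J2|r1 r2 J2|r1 r2 J2]; rewrite ?(rmorph0, rmorphB, rmorphM).
  + exact: ideal0.
  + exact: idealB.
  + exact: idealMl.
  + exact: Defs.idealMr.
- exists r; first by rewrite -as_; exact: Defs.idealMr.
  move=> r0; apply: a0; rewrite -[a]mulr1 -st mulrA as_ r0 rmorph0.
  by rewrite mul0r.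
have [w zw _] := inv z (conj zc z0) => c.
by rewrite -[c]mul1r -zw; do 2?apply: Defs.idealMr.
Qed.

Theorem proposition2p11 (K : closedFieldType) (q : K) (q0 : q != 0)
    (q_not_root : forall m : nat, (0 < m)%N -> q ^+ m != 1)
    (n : int) (n0 : n != 0) (f : laurent K) (fn0 : f@_n = 0) :
  let R : nzRingType := augmented_down_up q0 n f in
  (forall I : R -> Prop, two_sided_ideal I -> nonzero_ideal I ->
     exists z : R, [/\ I z, central z & z <> 0]) /\
  (forall (Q : pzRingType) (phi : {rmorphism R -> Q}),
     is_central_localization (fun z : R => central z /\ z <> 0) phi ->
     simple_ring Q).
Proof.
have center := ideal_meets_center (q0 := q0) q_not_root n0 (f := f).
split; first exact: center.
by move=> Q phi; exact: central_localization_simple center.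
Qed.
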